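(* Consider the two-sample setting with missingness patterns described in the context, let $T=T(Z_1^{\mathrm{obs}},S_1,\dots,Z_N^{\mathrm{obs}},S_N;G_1,\dots,G_N)$ be a test statistic, and let $\widetilde T$ denote the statistic computed using pattern-wise permutation. Under $H_0:F_X=F_Y$, a sufficient condition for $\widetilde T\overset{d}{=}T$ is $$\frac{P_{S\mid Z,G=X}(s\mid z)}{P_{S\mid G=X}(s)}=\frac{P_{S\mid Z,G=Y}(s\mid z)}{P_{S\mid G=Y}(s)}\qquad\text{for all } z,s \text{ with } P_{S\mid G}(s):=P_G(S=s)>0,$$ where $G\in\{X,Y\}$. This condition is strictly weaker than MCAR (missing completely at random), which requires $P_{S\mid Z,G}(s\mid z)=P_{S\mid G}(s)$ a.s. $F_G$ for all $s$, $G\in\{X,Y\}$.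
   Context: There are $L$ modalities (sources), the $l$-th defined on a domain $\mathcal S^{(l)}$. A full data vector is $Z=(Z^{(1)},\dots,Z^{(L)})$ and its missingness pattern is $S\in\{0,1\}^L$, where $S^{(l)}=1$ means modality $l$ is (entirely) observed and $S^{(l)}=0$ means it is entirely missing. There are two groups $G\in\{X,Y\}$; in group $G$ the full data satisfy $Z\sim F_G$, and the joint distribution of $(Z,S)$ is $P_{Z,S\mid G}(z,s)=P_{S\mid Z,G}(s\mid z)\,\frac{dF_G(z)}{dz}$, where the missingness mechanism $P_{S\mid Z,G}(s\mid z)$ is allowed to differ between groups. $P_{S\mid G}(s)=P_G(S=s)$ is the marginal probability of pattern $s$ in group $G$. The pooled sample consists of $N=m+n$ observations, formed from two independent samples: $m$ i.i.d. observations from group $X$ and $n$ i.i.d. observations from group $Y$; $G_i\in\{X,Y\}$ is the group label of observation $i$. Only $(Z_i^{\mathrm{obs}},S_i)$ is observed, where $Z_i^{\mathrm{obs}}$ is the subvector of $Z_i$ indexed by $\{l:S_i^{(l)}=1\}$. A test statistic $T$ is computed from the observed data $(Z_i^{\mathrm{obs}},S_i)$ with group labels $G_i$. Pattern-wise permutation scheme: let $\mathcal P_1,\dots,\mathcal P_{n_P}$ be the distinct missingness patterns observed in the data, and let $m_\alpha,n_\alpha$ be the numbers of group-$X$ and group-$Y$ observations with pattern $\mathcal P_\alpha$. Keeping $\{(Z_i^{\mathrm{obs}},S_i)\}$ fixed, the labels are permuted independently within each pattern $\mathcal P_\alpha$, uniformly over all assignments preserving $(m_\alpha,n_\alpha)$,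 giving $\widetilde G_1,\dots,\widetilde G_N$. Then $\widetilde T=T(Z_1^{\mathrm{obs}},S_1,\dots,Z_N^{\mathrm{obs}},S_N;\widetilde G_1,\dots,\widetilde G_N)$.
   Formalization: Added: labels are exchangeable or T ignores listing order (else T=1{G_1=X} with fixed labels is a counterexample); the ratio condition is a.s. in z, for s of positive probability in both groups; strictness is for L>0 and F not 0-1 valued. *)

(* Defs.v *)
From HB Require Import structures.
From mathcomp Require Import all_boot all_order all_algebra perm.
From mathcomp Require Import all_classical all_reals all_analysis.

Set Implicit Arguments.
Unset Strict Implicit.
Unset Printing Implicit Defensive.

Import Order.TTheory GRing.Theory Num.Theory.

Local Open Scope classical_set_scope.
Local Open Scope ring_scope.

(* Finite products of measurable spaces over an arbitrary index type, with the
   sigma-algebra generated by the coordinate maps. *)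
Section product_space.
Context (I : Type) (d : I -> measure_display).
Variable T : forall i, measurableType (d i).

Definition cylinders : set (set (forall i, T i)) :=
  [set A | exists i (B : set (T i)),
    measurable B /\ A = [set x | B (x i)]].

Definition prod_space := g_sigma_algebraType cylinders.

End product_space.

(* [option T] is [T] with one extra atom, [None], that stands for a missing
   value. *)
Section option_space.
Context (d : measure_display) (T : measurableType d).

Definition some_sets : set (set (option T)) :=
  [set Some @` B | B in (measurable : set (set T))].

Definition option_space := g_sigma_algebraType some_sets.

End option_space.

(* [tnth s l = true] when modality [l] is observed. *)
Notation pattern L := (L.-tuple bool) (only parsing).

(* The groups X and Y are [grpX] and [grpY]. *)
Notation grp := bool (only parsing).
Definition grpX : grp := true.
Definition grpY : grp := false.

Section observations.
Context (L : nat) (d : 'I_L -> measure_display).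
Variable dom : forall l, measurableType (d l).

Definition full_data := prod_space dom.

Definition masked_data := prod_space (fun l => option_space (dom l)).

Definition mask_missing (z : full_data) (s : pattern L) : masked_data :=
  fun l => if tnth s l then Some (z l) else None.

Definition observation := (masked_data * pattern L)%type.

Definition observe (zs : full_data * pattern L) : observation :=
  (mask_missing zs.1 zs.2, zs.2).

End observations.

Section missingness.
Context (R : realType) (L : nat) (d : 'I_L -> measure_display).
Context (dom : forall l, measurableType (d l)).
Implicit Types (F : grp -> probability (full_data dom) R).
(* [p G s z] is the conditional probability P_{S|Z,G}(s|z). *)
Implicit Types (p : grp -> pattern L -> full_data dom -> R).

Definition mechanism p :=
  [/\ forall G s, measurable_fun [set: full_data dom] (p G s),
      forall G s z, 0 <= p G s z &
      forall G z, \sum_(s : pattern L) p G s z = 1].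

(* P_{Z,S|G}(A x {s}): the integral over A of the joint density
   P_{S|Z,G}(s|z) dF_G(z). No dominating measure is needed. *)
Definition joint_law F p (G : grp) (A : set (full_data dom)) (s : pattern L)
    : \bar R :=
  (\int[F G]_(z in A) (p G s z)%:E)%E.

Definition pattern_prob F p (G : grp) (s : pattern L) : R :=
  fine (joint_law F p G setT s).

Definition same_law F :=
  forall A, measurable A -> F grpX A = F grpY A.

(* Conditional probabilities given Z are determined up to null sets only, hence
   the equality of the ratios is required almost surely. It is meaningful for
   the patterns that have positive probability in both groups. *)
Definition proportional_missingness F p :=
  forall s, (forall G, 0 < pattern_prob F p G s) ->
  forall G, {ae F G, forall z,
    p grpX s z / pattern_prob F p grpX s =
    p grpY s z / pattern_prob F p grpY s}.

Definition MCAR F p :=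
  forall G s, {ae F G, forall z, p G s z = pattern_prob F p G s}.

End missingness.

Definition permute (T : Type) (N : nat) (sigma : 'S_N) (x : N.-tuple T)
    : N.-tuple T :=
  [tuple tnth x (sigma i) | i < N].

Section sampling.
Context (R : realType) (L : nat) (d : 'I_L -> measure_display).
Context (dom : forall l, measurableType (d l)).
Context (dO : measure_display) (Omega : measurableType dO).
Variable P : probability Omega R.

Definition group_size (N : nat) (g : N.-tuple grp) (h : grp) : nat :=
  #|[set i | tnth g i == h]%SET|.

Definition full_sample (N : nat)
    (ZS : 'I_N -> {RV P >-> (full_data dom * pattern L)%type}) (w : Omega)
    : N.-tuple (full_data dom * pattern L) :=
  [tuple ZS i w | i < N].

Definition observed_sample (N : nat)
    (ZS : 'I_N -> {RV P >-> (full_data dom * pattern L)%type}) (w : Omega)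
    : N.-tuple (observation dom) :=
  [tuple of map (@observe L d dom) (full_sample ZS w)].

(* Given the labels, the observations are independent and the i-th one follows
   the joint law of its group. Labels that are fixed in advance are the case
   where [G] is constant. *)
Definition two_sample (F : grp -> probability (full_data dom) R)
    (p : grp -> pattern L -> full_data dom -> R) (m n : nat)
    (ZS : 'I_(m + n) -> {RV P >-> (full_data dom * pattern L)%type})
    (G : {RV P >-> ((m + n).-tuple grp)}) :=
  (forall w, group_size (G w) grpX = m /\ group_size (G w) grpY = n) /\
  forall (g : (m + n).-tuple grp) (A : 'I_(m + n) -> set (full_data dom))
    (s : 'I_(m + n) -> pattern L),
    (forall i, measurable (A i)) ->
    P (G @^-1` [set g] `&`
       [set w | forall i, (A i `*` [set s i]) (ZS i w)]) =
    (P (G @^-1` [set g]) *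
     \prod_(i < m + n) joint_law F p (tnth g i) (A i) (s i))%E.

Definition exchangeable_labels (N : nat) (G : {RV P >-> (N.-tuple grp)}) :=
  forall (g : N.-tuple grp) (sigma : 'S_N),
    P (G @^-1` [set permute sigma g]) = P (G @^-1` [set g]).

End sampling.

Section permutation_scheme.
Context (L N : nat).
Implicit Types (S : N.-tuple (pattern L)) (G g : N.-tuple grp).

Definition pattern_block S (a : pattern L) : {set 'I_N} :=
  [set i | tnth S i == a]%SET.

(* A labelling of a block [B] is encoded by the subset of [B] that is labelled
   X; its complement in [B] is labelled Y. *)
Definition labelled_X g (B : {set 'I_N}) : {set 'I_N} :=
  [set i in B | tnth g i == grpX]%SET.

(* Fixing the number of labels X of a block also fixes the number of labels Y. *)
Definition block_assignments G (B : {set 'I_N}) : {set {set 'I_N}} :=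
  [set A : {set 'I_N} | (A \subset B) && (#|A| == #|labelled_X G B|)]%SET.

(* Probability of the labelling [g]: the labellings of the blocks are
   independent, and each is uniform. An empty block contributes a factor 1. *)
Definition permutation_prob (R : realType) S G g : R :=
  \prod_(a : pattern L)
    ((labelled_X g (pattern_block S a)
        \in block_assignments G (pattern_block S a))%:R /
     #|block_assignments G (pattern_block S a)|%:R).

End permutation_scheme.

(* Conditional law of [Gt] given the observed data and the labels [G]. *)
Definition patternwise_permutation (R : realType) (L : nat)
    (d : 'I_L -> measure_display) (dom : forall l, measurableType (d l))
    (dO : measure_display) (Omega : measurableType dO)
    (P : probability Omega R) (N : nat)
    (ZS : 'I_N -> {RV P >-> (full_data dom * pattern L)%type})
    (G Gt : {RV P >-> (N.-tuple grp)}) :=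
  forall (C : set (N.-tuple (observation dom))) (g g' : N.-tuple grp),
    measurable C ->
    P (observed_sample ZS @^-1` C `&` G @^-1` [set g] `&` Gt @^-1` [set g']) =
    (\int[P]_(w in (observed_sample ZS @^-1` C `&` G @^-1` [set g])%classic)
      (permutation_prob R [tuple of map snd (observed_sample ZS w)] g g')%:E)%E.

Section statistics.
Context (R : realType) (L : nat) (d : 'I_L -> measure_display).
Context (dom : forall l, measurableType (d l)) (N : nat).
Implicit Types (T : N.-tuple (observation dom) -> N.-tuple grp -> R).

Definition test_statistic T :=
  forall g, measurable_fun [set: N.-tuple (observation dom)] (T ^~ g).

(* The value does not depend on the order in which the observations are listed. *)
Definition symmetric_statistic T :=
  forall (sigma : 'S_N) x g, T (permute sigma x) (permute sigma g) = T x g.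

End statistics.

Definition same_distribution (R : realType) (dO : measure_display)
    (Omega : measurableType dO) (P : probability Omega R) (U V : Omega -> R) :=
  forall B : set R, measurable B -> pushforward P U B = pushforward P V B.

(* Main.v *)
(* Under H0 and the ratio condition, the law of (Z, S) in group G factors as
   P_G(S = s) q_s(dz), where q_s does not depend on G. Given the labels g and
   the patterns s, the full data are therefore independent with laws q_(s_i), so
   that P(G = g, S = s, Z in .) depends on g only through P(G = g) and the number
   of labels X in each block of equal patterns. A relabelling within the blocks
   is induced by a permutation sigma of the indices that fixes s. If the labels
   are exchangeable, replacing g by its relabelling does not change this measure;
   if the statistic is symmetric, sigma can be moved from the labels to the data,
   whose law given (g, s) it preserves. The permutation probabilities form a
   symmetric stochastic matrix for each s, so averaging leaves the law of T
   unchanged. *)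
Require Import Defs.
From HB Require Import structures.
From mathcomp Require Import all_boot all_order all_algebra perm.
From mathcomp Require Import all_classical all_reals all_analysis.
From mathcomp Require Import measurable_realfun.
From mathcomp Require Import lra.

Set Implicit Arguments.
Unset Strict Implicit.
Unset Printing Implicit Defensive.

Import Order.TTheory GRing.Theory Num.Theory.

Local Open Scope classical_set_scope.
Local Open Scope ring_scope.

(** * Finite measures on tuples *)

(** A coordinate cylinder is a rectangle with all other sides full. Rectangles are moreover closed
    under intersection, as uniqueness of measures requires of a generating class. *)
Lemma g_sigma_preimage_tuple_rect d (U : measurableType d) N :
  (measurable : set (set (N.-tuple U))) =
  <<s [set [set x | forall i, B i (tnth x i)] |
        B in [set B : 'I_N -> set U | forall i, measurable (B i)]] >>.
Proof.
apply/seteqP; split.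
- apply: smallest_sub; first exact: smallest_sigma_algebra.
  rewrite -bigcup_seq /=; apply: bigcup_sub => i _ _ [A mA <-].
  apply: sub_sigma_algebra; exists (fun j => if j == i then A else setT) => /=.
    by move=> j; case: ifP.
  rewrite setTI; apply/seteqP; split => x /=.
    by move=> /(_ i); rewrite eqxx.
  by move=> Ax j; case: eqP => [->|].
- apply: smallest_sub; first exact: sigma_algebra_measurable.
  move=> _ [B mB <-].
  have -> : [set x : N.-tuple U | forall i, B i (tnth x i)] =
            \big[setI/setT]_(i < N) (@tnth N U ^~ i @^-1` B i).
    rewrite -bigcap_seq; apply/seteqP; split => x /= h i; first by move=> _; exact: h.
    by apply: h => /=; rewrite mem_index_enum.
  apply: bigsetI_measurable => i _.
  by rewrite -[X in measurable X]setTI; exact: measurable_tnth.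
Qed.

Section tuple_law.
Context (R : realType) d0 (Omega : measurableType d0) (P : probability Omega R).
Context d (U : measurableType d) (N : nat).

(** The finite measures [P (Dk and Xk in .)] agree on the pi-system of rectangles. Both the event
    and the random tuple may differ between the two sides: one use changes the labels, the other
    permutes the sample. *)
Lemma tuple_law_unique (D1 D2 : set Omega) (X1 X2 : Omega -> N.-tuple U) :
  measurable D1 -> measurable D2 ->
  measurable_fun setT X1 -> measurable_fun setT X2 ->
  (forall B : 'I_N -> set U, (forall i, measurable (B i)) ->
    P (D1 `&` [set w | forall i, B i (tnth (X1 w) i)]) =
    P (D2 `&` [set w | forall i, B i (tnth (X2 w) i)])) ->
  forall E, measurable E -> P (D1 `&` X1 @^-1` E) = P (D2 `&` X2 @^-1` E).
Proof.
move=> mD1 mD2 mX1 mX2 PB E mE.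
pose m1 : {measure set _ -> \bar R} := pushforward (mrestr P mD1) X1.
pose m2 : {measure set _ -> \bar R} := pushforward (mrestr P mD2) X2.
suff : m1 mX1 E = m2 mX2 E.
  by rewrite /m1 /m2 /= /pushforward /mrestr !(setIC _ D1) !(setIC _ D2).
apply: (measure_unique _ (fun=> setT) (g_sigma_preimage_tuple_rect U N)) => //.
- move=> _ _ [B mB <-] [C mC <-]; exists (fun i => B i `&` C i) => [i|].
    exact: measurableI.
  apply/seteqP; split => x /=.
    by move=> h; split=> i; have [] := h i.
  by move=> [xB xC] i; split.
- by move=> _; exists (fun=> setT) => //; apply/seteqP; split.
- by apply/seteqP; split => // x _; exists 0%N.
- move=> _ [B mB <-]; have := PB B mB.
  by rewrite /m1 /m2 /= /pushforward /mrestr !(setIC _ D1) !(setIC _ D2).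
- move=> _; rewrite /m1 /= /pushforward /mrestr preimage_setT setTI.
  by rewrite (le_lt_trans (probability_le1 _ _)) ?ltry.
Qed.
End tuple_law.

(** * Labellings with prescribed block counts *)

Section labellings.
Context (L N : nat).
Implicit Types (s : N.-tuple (pattern L)) (g : N.-tuple grp).

Definition same_counts s g g' := forall a,
  #|labelled_X g (pattern_block s a)| = #|labelled_X g' (pattern_block s a)|.

Lemma labelled_X_sub g (B : {set 'I_N}) : labelled_X g B \subset B.
Proof. by apply/fintype.subsetP => i; rewrite !inE => /andP[]. Qed.

Lemma count_zip s g a b :
  count_mem (a, b) [tuple (tnth s i, tnth g i) | i < N] =
  #|[set i | (tnth s i == a) && (tnth g i == b)]%SET|.
Proof.
rewrite cardsE cardE size_filter /= count_map /= -enumT.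
by apply: eq_count => i /=; rewrite -topredE /= xpair_eqE.
Qed.

(** Equal counts in every block mean that the tuples of pairs (pattern, label) built from [g] and
    [g'] have the same multiplicities, so one rearranges the other. Since the patterns belong to the
    pairs, the rearrangement fixes [s]. *)
Lemma same_counts_permute s g g' : same_counts s g g' ->
  exists sigma : 'S_N, permute sigma s = s /\ permute sigma g = g'.
Proof.
move=> sgg'.
have pX h a : [set i | (tnth s i == a) && (tnth h i == true)]%SET =
              labelled_X h (pattern_block s a).
  by apply/setP => i; rewrite !inE.
have pY h a : [set i | (tnth s i == a) && (tnth h i == false)]%SET =
              (pattern_block s a :\: labelled_X h (pattern_block s a))%SET.
  by apply/setP => i; rewrite !inE; case: (_ == a); case: (tnth h i).
have : perm_eq [tuple (tnth s i, tnth g' i) | i < N]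
               [tuple (tnth s i, tnth g i) | i < N].
  apply/allP => -[a b] _ /=; rewrite !count_zip.
  case: b; first by rewrite !pX sgg'.
  by rewrite !pY !cardsDS ?labelled_X_sub// sgg'.
move/tuple_permP => [sigma Esigma]; exists sigma.
have E i : (tnth s i, tnth g' i) = (tnth s (sigma i), tnth g (sigma i)).
  have /val_inj/(congr1 (@tnth _ _ ^~ i)) := Esigma.
  by rewrite !tnth_mktuple.
by split; apply: eq_from_tnth => i; rewrite tnth_mktuple; case: (E i).
Qed.

Lemma permutation_prob_neq0 (R : realType) s g g' :
  permutation_prob R s g g' != 0 -> same_counts s g g'.
Proof.
move=> /prodf_neq0 h a; have := h a isT.
by rewrite inE; case: andP => [[_ /eqP ->]//|_]; rewrite mul0r eqxx.
Qed.

(** Each factor is the indicator that two counts agree, divided by a number of assignments that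
    depends on the count only. *)
Lemma permutation_probC (R : realType) s g g' :
  permutation_prob R s g g' = permutation_prob R s g' g.
Proof.
apply: eq_bigr => a _.
rewrite !inE !labelled_X_sub /= /block_assignments [in LHS]eq_sym.
by case: eqP => [->|_]; rewrite ?mul0r.
Qed.

(** A labelling amounts to a choice of one subset per block, so the sum of products is a product
    over the blocks of sums of uniform weights, each equal to 1. *)
Lemma sum_permutation_prob (R : realType) s g :
  \sum_g' permutation_prob R s g g' = 1.
Proof.
pose Q a := block_assignments g (pattern_block s a).
pose lab g' := [ffun a => labelled_X g' (pattern_block s a)].
(* An index lies in the block of its own pattern only, so its label is read off that component of
   [f]. This inverts [lab] on families whose components are subsets of their blocks. *)
pose unlab (f : {ffun L.-tuple bool -> {set 'I_N}}) :=
  [tuple i \in f (tnth s i) | i < N].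
have Qgt0 a : (0 < #|Q a|)%N.
  apply/card_gt0P; exists (labelled_X g (pattern_block s a)).
  by rewrite inE eqxx labelled_X_sub.
have labK g' : unlab (lab g') = g'.
  apply: eq_from_tnth => i; rewrite tnth_mktuple ffunE !inE eqxx /=.
  by case: (tnth g' i).
have unlabK f : f \in family (fun a => mem (Q a)) -> lab (unlab f) = f.
  move=> /familyP fQ; apply/ffunP => a; rewrite ffunE; apply/setP => i.
  have := fQ a; rewrite !inE => /andP[/fintype.subsetP fa _].
  rewrite tnth_mktuple; apply/andP/idP => [[/eqP -> /eqP//]|ia].
  by have := fa _ ia; rewrite inE => /eqP E; rewrite E ia eqxx.
transitivity (\prod_a \sum_(A in Q a) (#|Q a|%:R^-1 : R)); last first.
  rewrite big1// => a _; rewrite sumr_const -[_ *+ _]mulr_natr mulVf//.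
  by rewrite pnatr_eq0 -lt0n.
rewrite bigA_distr_big_dep (reindex_onto lab unlab) /=; last exact: unlabK.
rewrite [RHS]big_mkcond; apply: eq_bigr => g' _.
rewrite labK eqxx andbT /permutation_prob.
case: ifPn => [/familyP h|/forallPn[a ha]].
  by apply: eq_bigr => a _; have := h a; rewrite ffunE /= => ->; rewrite mul1r.
apply/eqP/prodf_eq0; exists a => //; move: ha; rewrite ffunE /= => /negbTE ->.
by rewrite mul0r.
Qed.
End labellings.

(** * Proportional missingness *)

Section joint_law.
Context (R : realType) (L : nat) (d : 'I_L -> measure_display).
Context (dom : forall l, measurableType (d l)).
Variables (F : grp -> probability (full_data dom) R).
Variable (p : grp -> pattern L -> full_data dom -> R).
Hypothesis mp : mechanism p.

Lemma mechanism_le1 G s z : p G s z <= 1.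
Proof.
case: mp => _ p0 p1; rewrite -(p1 G z) (bigD1 s)//= lerDl.
by apply: sumr_ge0 => i _.
Qed.

Lemma mechanism_measurable G s (A : set (full_data dom)) :
  measurable_fun A (fun z => (p G s z)%:E).
Proof.
by case: mp => m _ _; apply/measurable_EFinP; apply: measurable_funS (m G s).
Qed.

Lemma joint_law_ge0 G A s : (0 <= joint_law F p G A s)%E.
Proof.
by case: mp => _ p0 _; apply: integral_ge0 => z _; rewrite lee_fin.
Qed.

Lemma joint_law_leT G A s : measurable A ->
  (joint_law F p G A s <= joint_law F p G setT s)%E.
Proof.
case: (mp) => _ p0 _ mA; apply: ge0_subset_integral => //.
- exact: mechanism_measurable.
- by move=> z _; rewrite lee_fin.
Qed.

(** The integral is at most 1 because [p G s z <= 1], so [fine] does not fall back on its default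
    value. *)
Lemma pattern_probE G s :
  (pattern_prob F p G s)%:E = joint_law F p G setT s.
Proof.
case: (mp) => _ p0 _.
apply: fineK; rewrite ge0_fin_numE ?joint_law_ge0//.
apply: (@le_lt_trans _ _ 1%E); last exact: ltry.
rewrite -(@probability_setT _ _ _ (F G)) -[leRHS]mul1e -integral_cst//.
apply: ge0_le_integral => //.
- by move=> z _; rewrite lee_fin.
- exact: mechanism_measurable.
- by move=> z _; rewrite lee_fin mechanism_le1.
Qed.

Lemma pattern_prob_ge0 G s : 0 <= pattern_prob F p G s.
Proof. by rewrite -lee_fin pattern_probE joint_law_ge0. Qed.

Lemma joint_law_eq0 G A s : measurable A -> pattern_prob F p G s = 0 ->
  joint_law F p G A s = 0%E.
Proof.
move=> mA pi0; apply/eqP; rewrite eq_le joint_law_ge0 andbT.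
by rewrite (le_trans (joint_law_leT _ _ mA))// -pattern_probE pi0.
Qed.

Hypothesis H0 : same_law F.

Lemma same_law_eq G G' A : measurable A -> F G A = F G' A.
Proof. by case: G; case: G' => // mA; rewrite H0. Qed.

Lemma same_law_integral G G' A (f : full_data dom -> \bar R) :
  (\int[F G]_(z in A) f z = \int[F G']_(z in A) f z)%E.
Proof. by apply: eq_measure_integral => B mB _; exact: same_law_eq. Qed.

Lemma same_law_ae G G' (Q : full_data dom -> Prop) :
  {ae F G, forall z, Q z} -> {ae F G', forall z, Q z}.
Proof.
by move=> [N [mN N0 QN]]; exists N; split=> //; rewrite (same_law_eq G' G).
Qed.

(** For a pattern of positive probability in both groups, [q] is the law of Z given S = s. The ratio
    condition says that its density with respect to the common law of Z is the same in both
    groups. *)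
Lemma joint_law_factor s : proportional_missingness F p ->
  exists q : set (full_data dom) -> \bar R, forall G A, measurable A ->
    joint_law F p G A s = ((pattern_prob F p G s)%:E * q A)%E.
Proof.
case: (mp) => _ p0 _ prop.
have scale G A : pattern_prob F p G s != 0 -> (joint_law F p G A s =
    (pattern_prob F p G s)%:E * ((pattern_prob F p G s)^-1%:E * joint_law F p G A s))%E.
  by move=> pi0; rewrite muleA -EFinM divff// mul1e.
have [pos|/existsNP[G0 /negP]] := pselect (forall G, 0 < pattern_prob F p G s).
  pose c := (pattern_prob F p grpX s)^-1.
  have c0 : 0 <= c by rewrite invr_ge0 pattern_prob_ge0.
  exists (fun A => c%:E * joint_law F p grpX A s)%E => G A mA.
  rewrite muleA -EFinM /joint_law (same_law_integral grpX G).
  rewrite -ge0_integralZl//; last 3 first.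
  - exact: mechanism_measurable.
  - by move=> z _; rewrite lee_fin.
  - by rewrite lee_fin mulr_ge0// pattern_prob_ge0.
  apply: ge0_ae_eq_integral => //.
  - exact: mechanism_measurable.
  - by apply: measurable_funeM; exact: mechanism_measurable.
  - by move=> z _; rewrite lee_fin.
  - move=> z _; rewrite -EFinM lee_fin !mulr_ge0// pattern_prob_ge0//.
  - have [N [mN N0 sN]] := prop s pos G; exists N; split=> // z /= zN.
    apply: sN => /= zE; apply: zN => _; rewrite -EFinM; congr EFin.
    have E : p G s z / pattern_prob F p G s = p grpX s z * c.
      by case: G pos zE {N0 mN} => // pos ->.
    rewrite -mulrA (mulrC c) -E mulrC divfK//.
    by rewrite gt_eqF ?pos.
rewrite -leNgt le_eqVlt ltNge pattern_prob_ge0 orbF => /eqP piG0.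
(* Group [G0] never shows the pattern, so its identity reads 0 = 0 for any [q]; hence [q] is
   normalised from the other group. If that probability vanishes too, both sides are again 0. *)
exists (fun A => (pattern_prob F p (~~ G0) s)^-1%:E * joint_law F p (~~ G0) A s)%E.
move=> G A mA; have [pi0|pi0] := eqVneq (pattern_prob F p G s) 0.
  by rewrite joint_law_eq0// pi0 mul0e.
suff -> : ~~ G0 = G by exact: scale.
by case: G G0 piG0 pi0 => -[] //= ->; rewrite eqxx.
Qed.

(** Off two null sets both ratios equal 1. Each null set belongs to the law of its own group, and H0
    carries both to the same group. *)
Lemma MCAR_proportional : MCAR F p -> proportional_missingness F p.
Proof.
move=> mcar s pos G.
have [N1 [mN1 N10 s1]] := same_law_ae G (mcar grpX s).
have [N2 [mN2 N20 s2]] := same_law_ae G (mcar grpY s).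
exists (N1 `|` N2); split; first exact: measurableU.
  exact: null_set_setU.
move=> z /= zN; apply: contrapT => /not_orP[zN1 zN2]; apply: zN.
have -> : p grpX s z = pattern_prob F p grpX s by apply: contrapT => /s1.
have -> : p grpY s z = pattern_prob F p grpY s by apply: contrapT => /s2.
by rewrite !divff// gt_eqF.
Qed.

End joint_law.

(** * Strictness: proportional missingness without MCAR *)

Section strictness.
Context (R : realType) (L : nat) (d : 'I_L -> measure_display).
Context (dom : forall l, measurableType (d l)).
Variables (F : grp -> probability (full_data dom) R).
Hypothesis H0 : same_law F.

Lemma common_mechanism_proportional (r : pattern L -> full_data dom -> R) :
  proportional_missingness F (fun=> r).
Proof.
move=> s _ G; rewrite /pattern_prob /joint_law.
by rewrite (same_law_integral H0 grpX grpY); exact: aeW.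
Qed.

(** A mechanism shared by the groups is proportional under H0, so it suffices that it takes
    different values on [A] and on its complement, neither of them null. [0 < L] provides two
    distinct patterns. If all events had probability 0 or 1, every mechanism would be almost surely
    constant, hence MCAR. *)
Lemma proportional_not_MCAR : (0 < L)%N ->
  (exists A : set (full_data dom),
     [/\ measurable A, (0 < F grpX A)%E & (F grpX A < 1)%E]) ->
  exists p : grp -> pattern L -> full_data dom -> R,
    [/\ mechanism p, (forall G s, 0 < pattern_prob F p G s),
        proportional_missingness F p & ~ MCAR F p].
Proof.
move=> L0 [A [mA A0 A1]].
pose s0 : pattern L := [tuple true | i < L].
pose s1 : pattern L := [tuple false | i < L].
have s01 : s0 != s1.
  apply/eqP => /(congr1 (fun t => tnth t (Ordinal L0))).
  by rewrite !tnth_mktuple.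
pose K : R := #|{: pattern L}|%:R.
have K0 : 0 < K by rewrite ltr0n; apply/card_gt0P; exists s0.
pose c s : R := (s == s0)%:R - (s == s1)%:R.
(* The distribution of the pattern is uniform off [A]; on [A], half of the
   mass of [s1] moves to [s0]. *)
pose r s (z : full_data dom) : R := K^-1 * (1 + c s / 2 * \1_A z).
have sumc : \sum_s c s = 0.
  rewrite sumrB; apply/eqP; rewrite subr_eq0; apply/eqP.
  by rewrite -!natr_sum -!big_mkcond /= !sum1_card !card1.
(* This bound gives both the nonnegativity of [r] and the positivity of all pattern
   probabilities. *)
have rge s z : K^-1 / 2 <= r s z.
  rewrite /r ler_pM2l ?invr_gt0// indicE /c.
  by case: (_ == s0); case: (_ == s1); case: (_ \in _) => /=; lra.
have mp : mechanism (fun _ : grp => r).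
  split=> [_ s|_ s z|_ z].
  - apply: measurable_funM => //; apply: measurable_funD => //.
    by apply: measurable_funM => //; exact: measurable_indic.
  - by rewrite (le_trans _ (rge s z))// divr_ge0// invr_ge0 ltW.
  - rewrite -mulr_sumr big_split /= -!mulr_suml sumc !mul0r addr0.
    by rewrite sumr_const -/K mulVf// gt_eqF.
exists (fun=> r); split => //.
- move=> G s; rewrite -lte_fin pattern_probE//.
  apply: (@lt_le_trans _ _ (K^-1 / 2)%:E).
    by rewrite lte_fin divr_gt0// invr_gt0.
  rewrite -[leLHS]mule1 -(@probability_setT _ _ _ (F G)) -integral_cst//.
  apply: ge0_le_integral => //.
  - by move=> z _; rewrite lee_fin divr_ge0// invr_ge0 ltW.
  - exact: mechanism_measurable mp G s _.
  - by move=> z _; rewrite lee_fin.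
- exact: common_mechanism_proportional.
move=> /(_ grpX s0); set c0 := pattern_prob _ _ _ _ => -[N [mN N0 sN]].
have FN B : measurable B -> B `<=` N -> F grpX B = 0%E.
  by move=> mB BN; exact: subset_measure0 BN N0.
have rA z : A z -> r s0 z = K^-1 * (3 / 2).
  move=> Az; rewrite /r indicE mem_set// /c eqxx (negbTE s01) subr0 mulr1.
  by congr (_ * _) => /=; lra.
have rnA z : ~ A z -> r s0 z = K^-1.
  by move=> Az; rewrite /r indicE memNset// mulr0 addr0 mulr1.
(* The constant [c0] cannot match both values of [r s0]: it misses the value on [A] or the one off
   [A], and that set would then be null. *)
have [c0E|c0E] := eqVneq c0 K^-1.
  suff : F grpX A = 0%E by move=> E; rewrite E ltxx in A0.
  apply: FN => // z Az; apply: sN => /=; rewrite rA// c0E => /eqP.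
  by rewrite -[X in _ == X]mulr1 (inj_eq (mulfI _)) ?invr_neq0 ?gt_eqF//; lra.
suff : F grpX (~` A) = 0%E.
  move=> E; have := probability_setC (F grpX) mA; rewrite E => /esym /eqP.
  rewrite sube_eq ?fin_num_measure// add0e => /eqP E1.
  by rewrite -E1 ltxx in A1.
apply: FN; first exact: measurableC.
by move=> z Az; apply: sN => /=; rewrite rnA// => /eqP; rewrite eq_sym (negbTE c0E).
Qed.
End strictness.

(** * Pattern-wise permutation *)

Section finite_fibers.
Context (R : realType) d0 (Omega : measurableType d0) (P : probability Omega R).

(** The pieces are given by an equivalence so that, inside a piece, the random index can be written
    as its fixed value [k]. *)
Lemma probability_sum_fibers (I : finType) (K : Omega -> I) (E : set Omega)
    (A : I -> set Omega) :
  (forall k, measurable (A k)) -> (forall k w, A k w <-> E w /\ K w = k) ->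
  P E = (\sum_k P (A k))%E.
Proof.
move=> mA AE; rewrite (fsbig_seq _ _ (index_enum_uniq I)).
rewrite -measure_fin_bigcup//.
- congr (P _); apply/seteqP; split => [w Ew|w [k _ /AE[]//]].
  by exists (K w); [rewrite /= mem_index_enum|exact/AE].
- apply/trivIsetP => i j _ _ ij; apply/seteqP; split => // w [/AE[_ Ki] /AE[_ Kj]].
  by rewrite -Ki -Kj eqxx in ij.
Qed.

End finite_fibers.

Lemma measurable_tuple_set1 d (T : measurableType d) N (t : N.-tuple T) :
  (forall x : T, measurable [set x]) -> measurable [set t].
Proof.
move=> m1; have -> : [set t] =
    \big[setI/setT]_(i < N) (@tnth N T ^~ i @^-1` [set tnth t i]).
  rewrite -bigcap_seq; apply/seteqP; split => [x -> //|x /= h].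
  by apply: eq_from_tnth => i; apply: h => /=; rewrite mem_index_enum.
apply: bigsetI_measurable => i _.
by rewrite -[X in measurable X]setTI; exact: measurable_tnth.
Qed.

(** * Measurability of the observation map *)

Section observe.
Context (L : nat) (d : 'I_L -> measure_display).
Context (dom : forall l, measurableType (d l)).

Lemma measurable_coordinate l :
  measurable_fun setT (fun z : full_data dom => z l : dom l).
Proof.
move=> _ B mB; rewrite setTI; apply: sub_sigma_algebra.
by exists l, B.
Qed.

Lemma measurable_Some d' (T : measurableType d') :
  measurable_fun setT (Some : T -> option_space T).
Proof.
apply: (@measurability _ _ T (option_space T) setT Some (@some_sets _ T)) =>
  // _ [_ [B mB <-] <-].
rewrite setTI (_ : _ @^-1` _ = B)//.
by apply/seteqP; split => [x [y By [<-]]//|x Bx]; exists x.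
Qed.

Lemma measurable_observe : measurable_fun setT (@observe L d dom).
Proof.
apply/measurable_fun_pair => //.
apply: (@measurability _ _ _ (masked_data dom) setT _
  (@cylinders _ _ (fun l => option_space (dom l)))) => //.
move=> _ [_ [l [B [mB ->]]] <-].
pose f (zs : full_data dom * pattern L) : option_space (dom l) :=
  if tnth zs.2 l then Some (zs.1 l) else None.
have mf : measurable_fun [set: full_data dom * pattern L] f.
  apply: measurable_fun_ifT => //.
  - apply: (measurableT_comp (measurable_tnth l)) => //.
  - have mc : measurable_fun [set: full_data dom * pattern L]
        (fun zs : full_data dom * pattern L => zs.1 l : dom l).
      exact: (measurableT_comp (measurable_coordinate (l := l)) measurable_fst).
    exact: (measurableT_comp (@measurable_Some _ (dom l)) mc).
have := mf measurableT B mB.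
congr measurable.
Qed.
End observe.

Definition tuple_map (A B : Type) (f : A -> B) {k : nat}
    (x : k.-tuple A) : k.-tuple B :=
  [tuple of map f x].

Lemma permute_map_tuple (A B : Type) (f : A -> B) (k : nat) (sigma : 'S_k)
    (x : k.-tuple A) :
  permute sigma (tuple_map f x) = tuple_map f (permute sigma x).
Proof. by apply: eq_from_tnth => i; rewrite !(tnth_map, tnth_mktuple). Qed.

Lemma measurable_map_tuple d1 d2 (T1 : measurableType d1)
    (T2 : measurableType d2) (f : T1 -> T2) (k : nat) :
  measurable_fun setT f ->
  measurable_fun setT (@tuple_map _ _ f k : k.-tuple T1 -> k.-tuple T2).
Proof.
move=> mf; apply/measurable_fun_tnthP => i.
rewrite (_ : _ \o _ = f \o (@tnth k T1 ^~ i)).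
  exact: (measurableT_comp mf (@measurable_tnth _ _ _ i)).
by apply/funext => x /=; rewrite tnth_map.
Qed.

(** * Equality in law of the permuted and the original statistic *)

Section sufficiency.
Context (R : realType) (L : nat) (d : 'I_L -> measure_display).
Context (dom : forall l, measurableType (d l)).
Variables (F : grp -> probability (full_data dom) R).
Variable (p : grp -> pattern L -> full_data dom -> R).
Hypotheses (H0 : same_law F) (mp : mechanism p).
Hypothesis (prop : proportional_missingness F p).
Context (m n : nat) (dO : measure_display) (Omega : measurableType dO).
Variable P : probability Omega R.
Variable ZS : 'I_(m + n) -> {RV P >-> (full_data dom * pattern L)%type}.
Variables G Gt : {RV P >-> ((m + n).-tuple grp)}.

Let N := (m + n)%N.

Definition patterns (w : Omega) : N.-tuple (pattern L) :=
  [tuple (ZS i w).2 | i < N].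

Lemma map_snd_observed w :
  tuple_map snd (observed_sample ZS w) = patterns w.
Proof. by apply: eq_from_tnth => i; rewrite !tnth_map. Qed.

Lemma measurable_full_sample : measurable_fun setT (full_sample ZS).
Proof.
apply/measurable_fun_tnthP => i.
rewrite (_ : _ \o _ = ZS i); first exact: measurable_funPT.
by apply/funext => w /=; rewrite tnth_mktuple.
Qed.

Lemma measurable_observed_sample : measurable_fun setT (observed_sample ZS).
Proof.
exact: (measurableT_comp (measurable_map_tuple (@measurable_observe L d dom))
                         measurable_full_sample).
Qed.

Lemma measurable_pattern_set1 (s : pattern L) : measurable [set s].
Proof. exact: measurable_tuple_set1. Qed.

Lemma measurable_patterns : measurable_fun setT patterns.
Proof.
apply/measurable_fun_tnthP => i.
rewrite (_ : _ \o _ = snd \o ZS i).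
  exact: (measurableT_comp measurable_snd (measurable_funPT (ZS i))).
by apply/funext => w /=; rewrite tnth_mktuple.
Qed.

Lemma measurable_patterns_fiber s : measurable (patterns @^-1` [set s]).
Proof.
rewrite -[X in measurable X]setTI; apply: measurable_patterns => //.
by apply: measurable_tuple_set1; exact: measurable_pattern_set1.
Qed.

Lemma measurable_labels_fiber (X : {RV P >-> (N.-tuple grp)}) g :
  measurable (X @^-1` [set g]).
Proof.
rewrite -[X in measurable X]setTI; apply: measurable_funPT => //.
exact: measurable_tuple_set1.
Qed.

Hypothesis sample : two_sample F p ZS G.

(** Once the patterns are fixed, only the section of [B i] at the i-th pattern matters. The
    factorisation then isolates all dependence on the labels in the first two factors. *)
Lemma rectangle_law (q : pattern L -> set (full_data dom) -> \bar R) :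
  (forall s h A, measurable A ->
    joint_law F p h A s = ((pattern_prob F p h s)%:E * q s A)%E) ->
  forall g s (B : 'I_N -> set (full_data dom * pattern L)),
  (forall i, measurable (B i)) ->
  P ((G @^-1` [set g] `&` patterns @^-1` [set s]) `&`
     [set w | forall i, B i (tnth (full_sample ZS w) i)]) =
  (P (G @^-1` [set g]) *
   \prod_(i < N) (pattern_prob F p (tnth g i) (tnth s i))%:E *
   \prod_(i < N) q (tnth s i) (ysection (B i) (tnth s i)))%E.
Proof.
move=> qE g s B mB; rewrite -muleA -big_split /=.
under [in RHS]eq_bigr => i _.
  rewrite -qE; last exact: measurable_ysection.
  over.
have [_ <-] := sample.
- congr (P _); rewrite -setIA; congr (_ `&` _); apply/seteqP; split => w /=.
    move=> [sE h] i; have := h i; rewrite tnth_mktuple /setX /= ysectionE /=.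
    by rewrite -sE tnth_mktuple -surjective_pairing.
  move=> h; split.
    by apply: eq_from_tnth => i; rewrite tnth_mktuple; have [_ ->] := h i.
  move=> i; rewrite tnth_mktuple; have := h i.
  by rewrite /setX /= ysectionE /= => -[hB hs]; rewrite -hs -surjective_pairing in hB.
- by move=> i; exact: measurable_ysection.
Qed.

Variables (T : N.-tuple (observation dom) -> N.-tuple grp -> R).
Hypothesis mT : test_statistic T.

Definition cell_event (B : set R) s g :=
  [set x : N.-tuple (observation dom) |
    tuple_map snd x = s /\ B (T x g)].

Lemma measurable_cell_event B s g : measurable B ->
  measurable (cell_event B s g).
Proof.
move=> mB; rewrite (_ : cell_event _ _ _ =
   tuple_map snd @^-1` [set s] `&` T ^~ g @^-1` B); last first.
  by apply/seteqP; split.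
apply: measurableI.
  rewrite -[X in measurable X]setTI.
  apply: (measurable_map_tuple measurable_snd) => //.
  by apply: measurable_tuple_set1; exact: measurable_pattern_set1.
by rewrite -[X in measurable X]setTI; exact: mT.
Qed.

(** [g] is the value of the actual labels and [g'] the labelling fed to the statistic; keeping them
    apart allows either to be changed alone. *)
Definition cell_prob B s g g' :=
  P (observed_sample ZS @^-1` cell_event B s g' `&` G @^-1` [set g]).

Definition statistic_event (B : set R) g :=
  [set x | B (T (tuple_map (@observe L d dom) x) g)].

Lemma measurable_statistic_event B g : measurable B ->
  measurable (statistic_event B g).
Proof.
move=> mB; have := measurableT_comp (mT g)
  (measurable_map_tuple (@measurable_observe L d dom)).
by move=> /(_ measurableT B mB); rewrite setTI.
Qed.

(** The product law concerns the full data, so the event is pulled back from the observed sample to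
    the full one. *)
Lemma cell_probE B s g g' : cell_prob B s g g' =
  P ((G @^-1` [set g] `&` patterns @^-1` [set s]) `&`
     full_sample ZS @^-1` statistic_event B g').
Proof.
congr (P _); apply/seteqP; split => w /=; rewrite /cell_event /=.
  by rewrite map_snd_observed => -[[-> ?] ->].
by rewrite map_snd_observed => -[[-> ->] ?].
Qed.

Lemma measurable_labels_patterns g s :
  measurable (G @^-1` [set g] `&` patterns @^-1` [set s]).
Proof.
by apply: measurableI; [exact: measurable_labels_fiber|
                        exact: measurable_patterns_fiber].
Qed.

(** In the rectangle law, exchangeability preserves P(G = g), reindexing by [sigma] preserves the
    product of pattern probabilities because [sigma] fixes [s], and the [q] factors do not see the
    labels. *)
Lemma cell_prob_exchangeable B s g (sigma : 'S_N) : exchangeable_labels G ->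
  measurable B -> permute sigma s = s ->
  cell_prob B s g (permute sigma g) =
  cell_prob B s (permute sigma g) (permute sigma g).
Proof.
move=> exch mB sE.
have /choice[q qE] := fun s' => joint_law_factor mp H0 s' prop.
have mE := measurable_statistic_event (permute sigma g) mB.
have sEi i : tnth s (sigma i) = tnth s i by rewrite -{2}sE tnth_mktuple.
rewrite !cell_probE; apply: (tuple_law_unique _ _ _ _ _ mE).
- exact: measurable_labels_patterns.
- exact: measurable_labels_patterns.
- exact: measurable_full_sample.
- exact: measurable_full_sample.
- move=> A mA; rewrite !(rectangle_law qE)// exch; congr (_ * _ * _)%E.
  rewrite (reindex_inj (@perm_inj _ sigma)) /=; apply: eq_bigr => i _.
  by rewrite tnth_mktuple sEi.
Qed.

(** Here the actual labels stay at [g] and symmetry moves [sigma] to the data. Given [g] and [s],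
    the data have independent coordinates with laws depending on the patterns only, so [sigma]
    preserves their joint law. *)
Lemma cell_prob_symmetric B s g (sigma : 'S_N) : symmetric_statistic T ->
  measurable B -> permute sigma s = s ->
  cell_prob B s g (permute sigma g) = cell_prob B s g g.
Proof.
move=> symT mB sE.
have /choice[q qE] := fun s' => joint_law_factor mp H0 s' prop.
have mE := measurable_statistic_event (permute sigma g) mB.
have sEi i : tnth s (sigma i) = tnth s i by rewrite -{2}sE tnth_mktuple.
have -> : cell_prob B s g g =
    P ((G @^-1` [set g] `&` patterns @^-1` [set s]) `&`
       (permute sigma \o full_sample ZS) @^-1`
         statistic_event B (permute sigma g)).
  rewrite cell_probE; congr (P (_ `&` _)); apply/seteqP.
  by split => w /=; rewrite /statistic_event /= -permute_map_tuple symT.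
rewrite cell_probE; apply: (tuple_law_unique _ _ _ _ _ mE).
- exact: measurable_labels_patterns.
- exact: measurable_labels_patterns.
- exact: measurable_full_sample.
- apply/measurable_fun_tnthP => i.
  rewrite (_ : _ \o _ = ZS (sigma i)); first exact: measurable_funPT.
  by apply/funext => w /=; rewrite !tnth_mktuple.
- move=> A mA; rewrite (rectangle_law qE)//.
  (* A rectangle constraint on the permuted sample is one on the sample itself, with sides reindexed
     by the inverse of [sigma]. *)
  have -> : [set w | forall i,
                A i (tnth ((permute sigma \o full_sample ZS) w) i)] =
      [set w | forall i, A (sigma^-1%g i) (tnth (full_sample ZS w) i)].
    apply/seteqP; split => w /= h i.
      by have := h (sigma^-1%g i); rewrite tnth_mktuple permKV.
    by rewrite tnth_mktuple; have := h (sigma i); rewrite permK.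
  rewrite (@rectangle_law q qE g s (fun i => A (sigma^-1%g i)))//.
  congr (_ * _)%E.
  rewrite [RHS](reindex_inj (@perm_inj _ sigma)) /=; apply: eq_bigr => i _.
  by rewrite sEi permK.
Qed.

Hypothesis scheme : patternwise_permutation ZS G Gt.

Lemma measurable_cell B s g g' : measurable B ->
  measurable (observed_sample ZS @^-1` cell_event B s g' `&` G @^-1` [set g]).
Proof.
move=> mB; apply: measurableI; last exact: measurable_labels_fiber.
rewrite -[X in measurable X]setTI; apply: measurable_observed_sample => //.
exact: measurable_cell_event.
Qed.

(** On a cell the patterns are fixed, so the integrand in the scheme is constant. *)
Lemma permuted_cell_prob B s g g' : measurable B ->
  P (observed_sample ZS @^-1` cell_event B s g' `&` G @^-1` [set g]
     `&` Gt @^-1` [set g']) =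
  ((permutation_prob R s g g')%:E * cell_prob B s g g')%E.
Proof.
move=> mB; have mC := measurable_cell_event s g' mB.
rewrite scheme// -integral_cst; last exact: measurable_cell.
by apply: eq_integral => w; rewrite inE => -[[<- _] _].
Qed.

Lemma permuted_law_sum B : measurable B ->
  P [set w | B (T (observed_sample ZS w) (Gt w))] =
  (\sum_s \sum_g \sum_g'
    (permutation_prob R s g g')%:E * cell_prob B s g g')%E.
Proof.
move=> mB; under [RHS]eq_bigr do rewrite pair_bigA.
rewrite pair_bigA /=; under [RHS]eq_bigr do rewrite -permuted_cell_prob//.
apply: (@probability_sum_fibers _ _ _ _ _ (fun w => (patterns w, (G w, Gt w)))).
- move=> [s [g g']]; apply: measurableI; last exact: measurable_labels_fiber.
  exact: measurable_cell.
- move=> [s [g g']] w /=; rewrite /cell_event /= map_snd_observed; split.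
    by move=> [[[-> h] ->] E]; rewrite E.
  by move=> [h [-> -> E]]; rewrite E in h *.
Qed.

Lemma law_sum B : measurable B ->
  P [set w | B (T (observed_sample ZS w) (G w))] =
  (\sum_s \sum_g cell_prob B s g g)%E.
Proof.
move=> mB; rewrite pair_bigA /=.
apply: (@probability_sum_fibers _ _ _ _ _ (fun w => (patterns w, G w))).
- by move=> [s g]; exact: measurable_cell.
- move=> [s g] w /=; rewrite /cell_event /= map_snd_observed; split.
    by move=> [[-> h] E]; rewrite E.
  by move=> [h [-> E]]; rewrite E in h *.
Qed.

Lemma patternwise_permutation_same_distribution :
  exchangeable_labels G \/ symmetric_statistic T ->
  same_distribution P (fun w => T (observed_sample ZS w) (Gt w))
                      (fun w => T (observed_sample ZS w) (G w)).
Proof.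
move=> sym B mB; rewrite /pushforward.
transitivity (\sum_s \sum_g \sum_g'
    (permutation_prob R s g g')%:E * cell_prob B s g g')%E.
  exact: permuted_law_sum.
transitivity (\sum_s \sum_g cell_prob B s g g)%E; last exact/esym/law_sum.
apply: eq_bigr => s _.
have row g : (\sum_g' (permutation_prob R s g g')%:E * cell_prob B s g g =
              cell_prob B s g g)%E.
  rewrite -ge0_sume_distrl; last first.
    by move=> g' _; rewrite lee_fin; apply: prodr_ge0 => a _; rewrite divr_ge0.
  by rewrite sumEFin sum_permutation_prob mul1e.
(* A nonzero weight makes [g'] a permutation of [g] within the blocks; a zero weight annihilates
   both sides. [f] selects the labelling that is kept: [g'] for exchangeable labels, [g] for a
   symmetric statistic. *)
have move_cell (f : N.-tuple grp -> N.-tuple grp -> N.-tuple grp) :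
    (forall g sigma, permute sigma s = s -> cell_prob B s g (permute sigma g) =
      cell_prob B s (f g (permute sigma g)) (f g (permute sigma g))) ->
    forall g g', ((permutation_prob R s g g')%:E * cell_prob B s g g' =
      (permutation_prob R s g g')%:E * cell_prob B s (f g g') (f g g'))%E.
  move=> fE g g'; have [->|/permutation_prob_neq0/same_counts_permute] :=
    eqVneq (permutation_prob R s g g') 0; first by rewrite !mul0e.
  by move=> [sigma [sE <-]]; rewrite fE.
case: sym => [exch|symT].
- transitivity (\sum_g \sum_g'
      (permutation_prob R s g g')%:E * cell_prob B s g' g')%E.
    apply: eq_bigr => g _; apply: eq_bigr => g' _.
    apply: (move_cell (fun _ g' => g')) => ? ? ?.
    exact: cell_prob_exchangeable.
  (* The cell now depends on [g'], so the columns must sum to 1; symmetry of the weights reduces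
     this to the rows. *)
  rewrite exchange_big /=; apply: eq_bigr => g' _.
  by under eq_bigr do rewrite permutation_probC; exact: row.
- by apply: eq_bigr => g _; rewrite -[RHS]row; apply: eq_bigr => g' _;
    apply: (move_cell (fun g _ => g)) => ? ? ?; exact: cell_prob_symmetric.
Qed.

End sufficiency.

Theorem theorem2 (R : realType) (L : nat) (d : 'I_L -> measure_display)
    (dom : forall l : 'I_L, measurableType (d l))
    (F : grp -> probability (full_data dom) R) (H0 : same_law F) :
  [/\ (* sufficiency *)
      forall p : grp -> pattern L -> full_data dom -> R,
        mechanism p -> proportional_missingness F p ->
      forall (m n : nat) (dO : measure_display) (Omega : measurableType dO)
        (P : probability Omega R)
        (ZS : 'I_(m + n) -> {RV P >-> (full_data dom * pattern L)%type})
        (G Gt : {RV P >-> ((m + n).-tuple grp)})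
        (T : (m + n).-tuple (observation dom) -> (m + n).-tuple grp -> R),
        two_sample F p ZS G -> patternwise_permutation ZS G Gt ->
        test_statistic T -> exchangeable_labels G \/ symmetric_statistic T ->
        same_distribution P (fun w => T (observed_sample ZS w) (Gt w))
                            (fun w => T (observed_sample ZS w) (G w)),
      (* weaker than MCAR *)
      forall p : grp -> pattern L -> full_data dom -> R,
        mechanism p -> MCAR F p -> proportional_missingness F p &
      (* strictly *)
      (0 < L)%N ->
      (exists A : set (full_data dom),
         [/\ measurable A, (0 < F grpX A)%E & (F grpX A < 1)%E]) ->
      exists p : grp -> pattern L -> full_data dom -> R,
        [/\ mechanism p, (forall G s, 0 < pattern_prob F p G s),
            proportional_missingness F p & ~ MCAR F p]].
Proof.
split.
- move=> p mp prop m n dO Omega P ZS G Gt T sample scheme mT sym.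
  exact: (patternwise_permutation_same_distribution H0 mp prop sample mT scheme).
- by move=> p mp; exact: MCAR_proportional.
- exact: proportional_not_MCAR.
Qed.
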